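(* (1) For every integer $r\geq 1$ and every path $P$, $\mathrm{wcol}_r(P) \leq \lceil \log r\rceil + 2$. (2) For every integer $r\geq 1$ and every path $P$ on at least $2r$ vertices, $\mathrm{wcol}_r(P) \geq \lceil \log (r+1)\rceil + 1$.
   Context: All graphs are finite, simple, and undirected. All logarithms $\log$ are in base $2$. A ''path $P$'' here is a graph that is a path (on at least one vertex). The length of a path is its number of edges. Weak coloring numbers: let $G$ be a graph, let $\sigma$ be an ordering (linear order) of $V(G)$, and let $r\geq 0$ be an integer. For vertices $u,v$ of $G$, $u$ is weakly $r$-reachable from $v$ in $\sigma$ if there exists a path in $G$ with ends $u$ and $v$ of length at most $r$ such that $u\leq_\sigma w$ for every vertex $w$ on the path (in particular $v$ is weakly $r$-reachable from itself). Let $\mathrm{WReach}_r[G,\sigma,v]$ be the set of vertices weakly $r$-reachable from $v$ in $\sigma$. Define $\mathrm{wcol}_r(G,\sigma)=\max_{v\in V(G)}|\mathrm{WReach}_r[G,\sigma,v]|$ and $\mathrm{wcol}_r(G)=\min_\sigma \mathrm{wcol}_r(G,\sigma)$, where $\sigma$ ranges over all orderings of $V(G)$. *)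

(* Defs.v *)
(* MathComp *)
From mathcomp Require Import all_boot.

Set Implicit Arguments.
Unset Strict Implicit.
Unset Printing Implicit Defensive.

Record sgraph := SGraph {
  vertex :> finType;
  edge : rel vertex;
  edge_sym : symmetric edge;
  edge_irrefl : irreflexive edge }.

Definition path_edge n : rel 'I_n := fun i j => (i.+1 == j) || (j.+1 == i).

Lemma path_edge_sym n : symmetric (@path_edge n).
Proof. by move=> i j; rewrite /path_edge orbC. Qed.

Lemma path_edge_irrefl n : irreflexive (@path_edge n).
Proof. by move=> i; rewrite /path_edge orbb gtn_eqF. Qed.

Definition path_graph n := SGraph (@path_edge_sym n) (@path_edge_irrefl n).

Definition isomorphic (G H : sgraph) : Prop :=
  exists2 f : G -> H, bijective f & forall x y, edge (f x) (f y) = edge x y.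

(* The path must have at least one vertex, whence n.+1. *)
Definition is_path (G : sgraph) : Prop :=
  exists n, isomorphic G (path_graph n.+1).

(* An ordering s is encoded by its graph: (x, y) \in s means x <=_s y.
   Reflexivity follows from totality. *)
Definition linear_order (T : finType) (s : {set T * T}) : bool :=
  [&& [forall x, forall y, ((x, y) \in s) && ((y, x) \in s) ==> (x == y)],
      [forall x, forall y, forall z,
         ((x, y) \in s) && ((y, z) \in s) ==> ((x, z) \in s)]
    & [forall x, forall y, ((x, y) \in s) || ((y, x) \in s)]].

Definition enum_order (T : finType) : {set T * T} :=
  [set p | enum_rank p.1 <= enum_rank p.2].

Lemma enum_order_linear (T : finType) : linear_order (enum_order T).
Proof.
apply/and3P; split; apply/forallP=> x; apply/forallP=> y.
- apply/implyP; rewrite !inE /= -eqn_leq => /eqP/val_inj/enum_rank_inj ->.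
  exact: eqxx.
- apply/forallP=> z; apply/implyP; rewrite !inE /= => /andP[].
  exact: leq_trans.
- by rewrite !inE /=; exact: leq_total.
Qed.

Section WeakColoring.
Variables (r : nat) (G : sgraph).
Implicit Types (s : {set G * G}) (u v : G).

(* v :: p lists the vertices of a path of G with k edges. *)
Definition weakly_reachable s u v : bool :=
  [exists k : 'I_r.+1, exists p : k.-tuple G,
     [&& path (@edge G) v p, uniq (v :: p), last v p == u
       & all (fun w => (u, w) \in s) (v :: p)]].

Definition WReach s v : {set G} := [set u | weakly_reachable s u v].

Definition wcol_ord s : nat := \max_(v : G) #|WReach s v|.

(* Minimum over all linear orders; by enum_order_linear the seed of the arg min
   is itself one, so the selected order is a genuine minimizer. *)
Definition wcol : nat :=
  wcol_ord [arg min_(s < enum_order G | linear_order s) wcol_ord s].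

End WeakColoring.

(* Main.v *)
Require Import Defs.
From mathcomp Require Import all_boot zify.

(** On a path, numbered from one end to the other, the walks from [v] to [u]
    all sweep over the positions between [u] and [v], and one of them visits
    nothing else ([reach_coordP]).  So [u] is weakly [r]-reachable from [v]
    exactly when [u] is at distance at most [r] and is the least vertex of the
    interval spanned by [u] and [v].  Everything then happens on intervals of
    integers.

    Upper bound.  Let [r <= 2 ^ k].  Number the vertices from 1 and let the
    level of [i] be its 2-adic valuation, capped at [k].  Order the vertices by
    decreasing level, and from left to right within a level ([ruler_key]).
    Between two vertices of the same level [j < k] there is one of higher level
    ([level_between]), so at most one vertex of each such level is reachable
    from a given [v].  The vertices of level [k] are [2 ^ k] apart: at most one
    is reachable strictly to the left of [v], because of the distance, and at
    most one weakly to the right, because the nearer of two such vertices comes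
    earlier in the order and blocks the farther one.  In total [k + 2].

    Lower bound.  By induction on [k], for every order, every interval of
    [2 ^ k] vertices with [2 ^ k <= 2 * r + 1] contains a vertex reaching
    [k + 1] vertices of that interval ([interval_reach]).  In an interval of
    [2 ^ k.+1] vertices, let [m] be the least one.  On one side of [m] there is
    room for [2 ^ k] consecutive vertices next to [m].  The vertex given there
    by induction also reaches [m], which is least and at distance at most
    [2 ^ k <= r]. *)

Set Implicit Arguments.
Unset Strict Implicit.
Unset Printing Implicit Defensive.

(** * Coordinates on a path *)

Definition between a b c := (a <= c <= b) || (b <= c <= a).

Definition coordinate (G : sgraph) (pos : G -> nat) : Prop :=
  [/\ injective pos,
      forall x, pos x < #|G|,
      forall i, i < #|G| -> exists x, pos x = i
    & forall x y, edge x y = ((pos x).+1 == pos y) || ((pos y).+1 == pos x)].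

Lemma is_path_coordinate (G : sgraph) :
  is_path G -> exists pos : G -> nat, coordinate pos.
Proof.
case=> n [f bij_f edge_f].
have cardG : #|G| = n.+1 by rewrite (bij_eq_card bij_f) card_ord.
case: (bij_f) => g fK gK; exists (fun x => f x : nat); split.
- by move=> x y /val_inj/(can_inj fK).
- by move=> x; rewrite cardG ltn_ord.
- by move=> i; rewrite cardG => lt_i; exists (g (Ordinal lt_i)); rewrite gK.
- by move=> x y; rewrite -edge_f.
Qed.

(** A discrete intermediate value theorem: consecutive positions differ by one,
    so a walk cannot jump over a position. *)
Lemma walk_coord (G : sgraph) (pos : G -> nat) (v w : G) (p : seq G) :
  coordinate pos -> path (@edge G) v p ->
  [/\ pos (last v p) <= pos v + size p, pos v <= pos (last v p) + size p
    & between (pos (last v p)) (pos v) (pos w) -> w \in v :: p].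
Proof.
move=> [pos_inj _ _ edgeE]; elim: p v => [|x p IHp] v /=.
  move=> _; split; rewrite ?addn0 // => Hw.
  by rewrite inE; apply/eqP/pos_inj; move: Hw; rewrite /between; lia.
rewrite edgeE => /andP[vx /IHp[le1 le2 IHw]]; split; try lia.
move=> Hw; rewrite inE; case: (eqVneq w v) => //= /eqP ne_wv.
have ne_pos : pos w <> pos v by move=> /pos_inj.
by apply: IHw; move: Hw ne_pos vx; rewrite /between; lia.
Qed.

(** Stepping from [v] towards [u] leaves an interval that no longer contains
    [v]; this gives the absence of repetitions. *)
Lemma straight_walk (G : sgraph) (pos : G -> nat) (u v : G) d :
  coordinate pos -> (pos u == pos v + d) || (pos v == pos u + d) ->
  exists p : d.-tuple G,
    [/\ path (@edge G) v p, uniq (v :: p), last v p = u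
      & {in v :: p, forall w, between (pos u) (pos v) (pos w)}].
Proof.
move=> Hpos; case: (Hpos) => pos_inj pos_lt pos_surj edgeE.
elim: d v => [|d IHd] v Huv.
  have <- : v = u by apply: pos_inj; lia.
  exists [tuple]; split=> // w; rewrite inE => /eqP->.
  by rewrite /between leqnn.
have [x [vx Hux Hv]] : exists x, [/\ edge v x,
    (pos u == pos x + d) || (pos x == pos u + d)
    & forall c, between (pos u) (pos x) c ->
      between (pos u) (pos v) c && (c != pos v)].
  have [up|down] := orP Huv.
  - have [|x Hx] := pos_surj (pos v).+1.
      by have := pos_lt u; lia.
    by exists x; rewrite edgeE /between; split; lia.
  - have [|x Hx] := pos_surj (pos v).-1.
      by have := pos_lt v; lia.
    by exists x; rewrite edgeE /between; split; lia.
have [p [path_p uniq_p last_p Hp]] := IHd x Hux.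
exists [tuple of x :: p]; split=> //=.
- by rewrite vx.
- rewrite -/(uniq (x :: p)) uniq_p andbT; apply/negP => /Hp/Hv.
  by rewrite eqxx andbF.
- move=> w; rewrite inE => /predU1P[->|/Hp/Hv/andP[//]].
  by rewrite /between; lia.
Qed.

Lemma reach_coordP (r : nat) (G : sgraph) (pos : G -> nat) (s : {set G * G})
    (u v : G) :
  coordinate pos ->
  weakly_reachable r s u v <->
  [/\ pos u <= pos v + r, pos v <= pos u + r
    & forall w, between (pos u) (pos v) (pos w) -> (u, w) \in s].
Proof.
move=> Hpos; split.
  move=> /existsP[k /existsP[p /and4P[path_p _ /eqP last_p /allP Hs]]].
  have Hw w := walk_coord w Hpos path_p.
  have [] := Hw v; rewrite last_p size_tuple => le1 le2 _.
  have := ltn_ord k; split; try lia.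
  by move=> w Hbtw; apply: Hs; have [_ _] := Hw w; rewrite last_p; apply.
case=> le1 le2 Hs.
have lt_d : pos u - pos v + (pos v - pos u) < r.+1 by lia.
have [|p [path_p uniq_p last_p Hp]] :=
  @straight_walk G pos u v (Ordinal lt_d) Hpos; first by rewrite /=; lia.
apply/existsP; exists (Ordinal lt_d); apply/existsP; exists p.
by apply/and4P; split=> //; [apply/eqP | apply/allP=> w /Hp/Hs].
Qed.

(** * Linear orders *)

Lemma key_order_linear (T : finType) (key : T -> nat) :
  injective key -> linear_order [set p | key p.1 <= key p.2].
Proof.
move=> key_inj; apply/and3P; split; apply/forallP=> x; apply/forallP=> y.
- by apply/implyP; rewrite !inE /= -eqn_leq => /eqP/key_inj->.
- by apply/forallP=> z; apply/implyP; rewrite !inE /= => /andP[/leq_trans]; apply.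
- by rewrite !inE /= leq_total.
Qed.

Lemma linear_order_min (T : finType) (s : {set T * T}) (A : {set T}) x0 :
  linear_order s -> x0 \in A ->
  exists2 m, m \in A & {in A, forall w, (m, w) \in s}.
Proof.
move=> /and3P[/forallP anti /forallP trans /forallP total] Ax0.
pose rank x := #|[set y | (y, x) \in s]|.
have [m Am min_m] := arg_minnP rank Ax0; exists m => // w /min_m le_mw.
have refl x : (x, x) \in s by have /forallP/(_ x) := total x; rewrite orbb.
have /forallP/(_ w)/orP[//|wm] := total m.
apply: contraLR le_mw => nmw; rewrite -ltnNge; apply/proper_card/properP; split.
  apply/subsetP=> y; rewrite !inE => yw.
  by have /forallP/(_ w)/forallP/(_ m) := trans y; rewrite yw wm.
by exists m; rewrite inE ?refl.
Qed.

Lemma wcol_le_ord (r : nat) (G : sgraph) (s : {set G * G}) :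
  linear_order s -> wcol r G <= wcol_ord r s.
Proof.
rewrite /wcol; case: arg_minnP => [|s0 _ min_s0]; first exact: enum_order_linear.
exact: min_s0.
Qed.

Lemma wcol_ord_witness (r : nat) (G : sgraph) :
  exists2 s : {set G * G}, linear_order s & wcol r G = wcol_ord r s.
Proof.
rewrite /wcol; case: arg_minnP => [|s Hs _]; first exact: enum_order_linear.
by exists s.
Qed.

(** * The upper bound: ruler orders *)

(** Positions start at 0; the shift avoids the valuation of 0. *)
Definition level k i := minn k (logn 2 i.+1).

Lemma dvdn_level k i : 2 ^ level k i %| i.+1.
Proof. by rewrite pfactor_dvdn // geq_minr. Qed.

(** Two odd multiples of [2 ^ j] are separated by an even one. *)
Lemma level_between k a b :
  a < b -> level k a = level k b -> level k a < k ->
  exists2 c, a < c < b & level k a < level k c.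
Proof.
move=> lt_ab; rewrite /level => eq_lev lt_lev.
pose j := logn 2 a.+1.
have eq_a : logn 2 a.+1 = j by [].
have eq_b : logn 2 b.+1 = j by lia.
have lt_jk : j < k by lia.
have [/dvdnP[x Ex] Na] : 2 ^ j %| a.+1 /\ ~~ (2 ^ j.+1 %| a.+1).
  by rewrite !pfactor_dvdn // eq_a leqnn ltnn.
have [/dvdnP[y Ey] Nb] : 2 ^ j %| b.+1 /\ ~~ (2 ^ j.+1 %| b.+1).
  by rewrite !pfactor_dvdn // eq_b leqnn ltnn.
have gt0 : 0 < 2 ^ j by rewrite expn_gt0.
rewrite Ex expnS dvdn_pmul2r // dvdn2 negbK in Na.
rewrite Ey expnS dvdn_pmul2r // dvdn2 negbK in Nb.
have lt_xy : x < y by rewrite -(ltn_pmul2r gt0) -Ex -Ey.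
have lt_x1y : x.+1 < y.
  by rewrite ltn_neqAle lt_xy andbT; apply: contraTneq Nb => <-; rewrite /= Na.
have lt_c : x.+1 * 2 ^ j < b.+1 by rewrite Ey ltn_pmul2r.
exists (a + 2 ^ j); first by move: lt_c; rewrite mulSn -Ex; lia.
have : 2 ^ j.+1 %| (a + 2 ^ j).+1.
  by rewrite -addSn Ex addnC -mulSn expnS dvdn_pmul2r // dvdn2 /= Na.
by rewrite pfactor_dvdn // eq_a; lia.
Qed.

(** Lexicographic: decreasing level first, then increasing position; [n] bounds
    the positions. *)
Definition ruler_key k n i := (k - level k i) * n + i.

Lemma ruler_key_le k n a b : a < n -> b < n -> ruler_key k n a <= ruler_key k n b ->
  level k b < level k a \/ level k b = level k a /\ a <= b.
Proof.
move=> lt_a lt_b; rewrite /ruler_key.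
have [le_a le_b] : level k a <= k /\ level k b <= k by rewrite !geq_minl.
case: (ltngtP (level k b) (level k a)) => [||->]; [by left| |]; last first.
  by rewrite leq_add2l; right.
move=> lt_lev le_key; exfalso.
have : (k - level k b).+1 * n <= (k - level k a) * n by rewrite leq_mul2r; lia.
by rewrite mulSn; lia.
Qed.

Lemma ruler_key_inj k n a b :
  a < n -> b < n -> ruler_key k n a = ruler_key k n b -> a = b.
Proof.
move=> lt_a lt_b eq_key.
have := @ruler_key_le k n a b lt_a lt_b; have := @ruler_key_le k n b a lt_b lt_a.
by rewrite eq_key leqnn => /(_ isT) ? /(_ isT) ?; lia.
Qed.

Lemma ruler_reach_card (r k : nat) (G : sgraph) (pos : G -> nat) (v : G) :
  coordinate pos -> r <= 2 ^ k ->
  #|WReach r [set p | ruler_key k #|G| (pos p.1) <= ruler_key k #|G| (pos p.2)] v|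
    <= k.+2.
Proof.
move=> Hpos le_r; case: (Hpos) => pos_inj pos_lt pos_surj _.
set s := [set p | _].
(* The cap level [k] receives two labels, one for each side of [v]. *)
pose label u := level k (pos u) + ((level k (pos u) == k) && (pos u < pos v)).
have le_lev i : level k i <= k by apply: geq_minl.
have label_lt u : label u < k.+2 by have := le_lev (pos u); rewrite /label; lia.
suff label_neq u1 u2 : u1 \in WReach r s v -> u2 \in WReach r s v ->
    pos u1 < pos u2 -> label u1 <> label u2.
  rewrite -[k.+2]card_ord.
  apply: (@leq_card_in _ _ (fun u => Ordinal (label_lt u))) => u1 u2 R1 R2 [eq_lab].
  apply: pos_inj; case: (ltngtP (pos u1) (pos u2)) => // [/label_neq|/label_neq].
    by move=> /(_ R1 R2).
  by move=> /(_ R2 R1) /(_ (esym eq_lab)).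
rewrite !inE !(reach_coordP _ _ _ _ Hpos) => -[le1 le1' min1] [le2 le2' min2] lt12 eq_lab.
have min_key u w : (u, w) \in s -> level k (pos w) < level k (pos u) \/
    level k (pos w) = level k (pos u) /\ pos u <= pos w.
  by rewrite inE; apply: ruler_key_le.
have [lev1 lev2] := (le_lev (pos u1), le_lev (pos u2)).
have eq_lev : level k (pos u1) = level k (pos u2) by move: eq_lab; rewrite /label; lia.
case: (ltnP (level k (pos u1)) k) => [lt_k|ge_k].
  (* Wherever [v] is, [c] lies between [v] and one of [u1], [u2]. *)
  have [c lt_c lev_c] := level_between lt12 eq_lev lt_k.
  have [|w Hw] := pos_surj c; first by have := pos_lt u2; lia.
  have [Hb|Hb] : between (pos u1) (pos v) (pos w) \/
      between (pos u2) (pos v) (pos w).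
  - by rewrite /between; lia.
  - by have := min_key _ _ (min1 _ Hb); rewrite Hw; lia.
  - by have := min_key _ _ (min2 _ Hb); rewrite Hw; lia.
have Hk : level k (pos u1) = k by lia.
case: (ltnP (pos u2) (pos v)) => [lt2v|le_v2].
  have : 2 ^ k %| (pos u2).+1 - (pos u1).+1.
    by apply: dvdn_sub; rewrite -{1}Hk; [rewrite eq_lev|]; apply: dvdn_level.
  by move=> /dvdn_leq; lia.
have le_v1 : pos v <= pos u1 by move: eq_lab; rewrite /label -eq_lev Hk eqxx; lia.
have Hb : between (pos u2) (pos v) (pos u1) by rewrite /between; lia.
by have := min_key _ _ (min2 _ Hb); lia.
Qed.

Lemma wcol_path_le (r k : nat) (G : sgraph) :
  is_path G -> r <= 2 ^ k -> wcol r G <= k.+2.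
Proof.
move=> /is_path_coordinate[pos Hpos] le_r; case: (Hpos) => pos_inj pos_lt _ _.
have lin := @key_order_linear G (fun x => ruler_key k #|G| (pos x)).
apply: leq_trans (wcol_le_ord r (lin _)) _.
  by move=> x y /ruler_key_inj eq_pos; apply/pos_inj/eq_pos.
by apply/bigmax_leqP => v _; apply: ruler_reach_card.
Qed.

(** * The lower bound *)

(** Counting only the reachable vertices inside the interval makes the induction
    work: the least vertex is outside the smaller interval, hence new. *)
Lemma interval_reach (r k a : nat) (G : sgraph) (pos : G -> nat)
    (s : {set G * G}) :
  coordinate pos -> linear_order s -> 2 ^ k <= (2 * r).+1 -> a + 2 ^ k <= #|G| ->
  exists2 v : G, a <= pos v < a + 2 ^ k
    & k < #|[set u in WReach r s v | a <= pos u < a + 2 ^ k]|.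
Proof.
move=> Hpos lin_s; case: (Hpos) => pos_inj pos_lt pos_surj _.
have refl x : (x, x) \in s.
  by case/and3P: lin_s => _ _ /forallP/(_ x)/forallP/(_ x); rewrite orbb.
elim: k a => [|k IHk] a le_r le_a.
  have [|v Hv] := pos_surj a; first lia.
  exists v; first lia.
  apply/card_gt0P; exists v; rewrite !inE Hv; apply/andP; split; last lia.
  apply/(reach_coordP _ _ _ _ Hpos); split; try lia.
  move=> w Hw; have <- : v = w by apply: pos_inj; move: Hw; rewrite /between; lia.
  exact: refl.
have gt0 : 0 < 2 ^ k by rewrite expn_gt0.
rewrite expnS in le_r le_a *.
have [|x0 Hx0] := pos_surj a; first lia.
pose A := [set x | a <= pos x < a + 2 * 2 ^ k].
have [|m] := @linear_order_min _ s A x0 lin_s; first by rewrite inE; lia.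
rewrite inE => Am min_m.
have [b [sub_b b_m near_m]] : exists b, [/\ a <= b /\ b + 2 ^ k <= a + 2 * 2 ^ k,
    ~~ (b <= pos m < b + 2 ^ k)
    & forall c, b <= c < b + 2 ^ k -> c <= pos m + 2 ^ k /\ pos m <= c + 2 ^ k].
  have [lt_m|ge_m] := ltnP (pos m) (a + 2 ^ k).
  - by exists (pos m).+1; split; lia.
  - by exists (pos m - 2 ^ k); split; lia.
have [||v Hv card_v] := IHk b; try lia.
exists v; first lia.
set S := [set u in _ | _] in card_v.
apply: (@leq_trans #|m |: S|).
  by rewrite cardsU1 !inE (negbTE b_m) andbF.
apply/subset_leq_card/subsetP=> u; rewrite !inE => /predU1P[->|/andP[-> Hu]]; last lia.
rewrite Am andbT; have [le_vm le_mv] := near_m _ Hv.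
apply/(reach_coordP _ _ _ _ Hpos); split; try lia.
by move=> w Hw; apply: min_m; rewrite inE; move: Hw; rewrite /between; lia.
Qed.

Lemma wcol_path_ge (r k : nat) (G : sgraph) :
  is_path G -> 2 ^ k <= (2 * r).+1 -> 2 ^ k <= #|G| -> k < wcol r G.
Proof.
move=> /is_path_coordinate[pos Hpos] le_r le_G.
have [s lin_s ->] := wcol_ord_witness r G.
have [v _ lt_k] := @interval_reach r k 0 G pos s Hpos lin_s le_r le_G.
apply: leq_trans lt_k (leq_trans _ (@leq_bigmax _ (fun v => #|WReach r s v|) v)).
by apply/subset_leq_card/subsetP=> u; rewrite inE => /andP[].
Qed.

Theorem theorem1 :
  (forall (r : nat) (P : sgraph), 1 <= r -> is_path P ->
     wcol r P <= up_log 2 r + 2) /\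
  (forall (r : nat) (P : sgraph), 1 <= r -> is_path P -> 2 * r <= #|P| ->
     up_log 2 r.+1 + 1 <= wcol r P).
Proof.
split=> r P r_gt0 pathP.
  by rewrite addn2; apply: wcol_path_le => //; apply: up_logP.
move=> le_P; rewrite addn1.
have le_log : 2 ^ up_log 2 r.+1 <= 2 * r.
  have /andP[lt_r _] := @up_log_bounds 2 r.+1 isT r_gt0.
  have lt_0 : 0 < up_log 2 r.+1 by rewrite up_log_gt0.
  by rewrite -(prednK lt_0) expnS leq_mul2l /= -ltnS.
by apply: wcol_path_ge => //; lia.
Qed.
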